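(* Consider the equilibrium of the $n$-firm economy as a function of the climate belief $\alpha_j^2$ of a single firm $j$, all other parameters being fixed, for $\alpha_j^2$ ranging over an interval $J\subseteq(0,\infty)$ of regime-preserving perturbations (see context). Let $K=K_{ex}+\sum_i r_iq_i$ be the total carbon and $Q=\sum_i q_i$ the total production quantity in equilibrium, seen as functions of $\alpha_j^2\in J$. The total carbon $K$ is weakly decreasing in the climate beliefs of all firms: (i) if $j$ is green, $K$ is constant on $J$; (ii) if $j$ is not green (i.e., orange or red), $K$ is strictly decreasing on $J$. The dependence of the total quantity $Q$ is as follows: (i) if $j$ is green, $Q$ is constant on $J$; (ii) if $j$ is red, $Q$ is strictly decreasing on $J$; (iii) if $j$ is orange, $Q$ is strictly increasing on $J$, except if there are no red firms in the economy, in which case $Q$ is constant on $J$.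
   Context: Model. There are $n\ge1$ firms; constants $A,b,c,d>0$ and $K_{ex}\ge0$ are given. Firm $i$ chooses a technology $r_i\in[0,1]$ and a quantity $q_i\in[0,\infty)$; its carbon emission is $k_i=r_iq_i$. The convention $r_i=0$ is imposed whenever $q_i=0$. The number $\alpha_i^2=E_i[\alpha^2]$ (a symbol for a nonnegative real, the second moment of a random variable $\alpha$ under firm $i$'s subjective belief) is called the climate belief of firm $i$. Put $Q=\sum_j q_j$, $K=K_{ex}+\sum_j r_jq_j$, $Q_{-i}=Q-q_i$, $K_{-i}=K-k_i$. The expected profit of firm $i$ for a choice $(r,q)\in[0,1]\times[0,\infty)$ is $$(A-q-Q_{-i})^+\,q-b\alpha_i^2\,(rq+K_{-i})\,rq-(c+d-dr)\,q .$$ An equilibrium (Nash) is a profile $(r_j,q_j)_{1\le j\le n}$ such that for every $i$, $(r_i,q_i)$ maximizes firm $i$'s expected profit over $[0,1]\times[0,\infty)$ given $Q_{-i}=\sum_{j\ne i}q_j$ and $K_{-i}=K_{ex}+\sum_{j\ne i}r_jq_j$. For all parameters there is a unique equilibrium. Colors (in equilibrium). Firm $i$ is white if $q_i=0$; green if $q_i>0$ and $r_i=0$; orange if $q_i>0$ and $0<r_i<1$; red if $q_i>0$ and $r_i=1$. Standing assumptions. All climate beliefs are strictly positive, $\alpha_i^2>0$, and there are no white firms. Only regime-preserving perturbations are considered: $J\subseteq(0,\infty)$ is a nondegenerate interval such that for all $\alpha_j^2\in J$ (other parameters fixed) the equilibrium has no white firm, and the color of every firm is constant for $\alpha_j^2$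 in the interior of $J$. ''Firm $i$ is green/orange/red'' refers to this constant color. *)

(* Defs.v *)
From mathcomp Require Import all_boot all_order all_algebra.
From mathcomp Require Import all_classical all_reals all_analysis.

Set Implicit Arguments.
Unset Strict Implicit.
Unset Printing Implicit Defensive.
Import Order.TTheory GRing.Theory Num.Theory.
Import numFieldNormedType.Exports.
Local Open Scope classical_set_scope.
Local Open Scope ring_scope.

Record profile (R : realType) (n : nat) := Profile {
  tech : 'I_n -> R;
  qty : 'I_n -> R
}.

Section Economy.
Variables (R : realType) (n : nat).
Implicit Types (p : profile R n) (i : 'I_n).

Definition total_quantity p : R := \sum_i qty p i.

Definition total_carbon (Kex : R) p : R := Kex + \sum_i tech p i * qty p i.

Definition others_quantity p i : R := \sum_(j | j != i) qty p j.

Definition others_carbon (Kex : R) p i : R :=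
  Kex + \sum_(j | j != i) tech p j * qty p j.

(* [a] is the climate belief, i.e. the second moment written alpha_i^2 (it is
   not squared again); [Qo], [Ko] are Q_{-i} and K_{-i}. *)
Definition profit (A b c d a Qo Ko r q : R) : R :=
  Num.max (A - q - Qo) 0 * q - b * a * (r * q + Ko) * (r * q)
  - (c + d - d * r) * q.

(* The last component is the convention r_i = 0 if q_i = 0. It makes the
   equilibrium unique, the technology of an idle firm being irrelevant for all
   profits. *)
Definition equilibrium (A b c d Kex : R) (a : 'I_n -> R) p : Prop :=
  forall i,
    let payoff :=
      profit A b c d (a i) (others_quantity p i) (others_carbon Kex p i) in
    [/\ 0 <= tech p i <= 1,
        0 <= qty p i,
        (forall r q : R, 0 <= r <= 1 -> 0 <= q ->
           payoff r q <= payoff (tech p i) (qty p i)) &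
        (qty p i = 0 -> tech p i = 0)].

Variant color := White | Green | Orange | Red.

Definition has_color p i (k : color) : bool :=
  match k with
  | White => qty p i == 0
  | Green => (0 < qty p i) && (tech p i == 0)
  | Orange => (0 < qty p i) && (0 < tech p i < 1)
  | Red => (0 < qty p i) && (tech p i == 1)
  end.

End Economy.

(* Main.v *)
Require Import Defs.
From mathcomp Require Import all_boot all_order all_algebra.
From mathcomp Require Import all_classical all_reals all_analysis.
From mathcomp Require Import ring lra.

Set Implicit Arguments.
Unset Strict Implicit.
Unset Printing Implicit Defensive.
Import Order.TTheory GRing.Theory Num.Theory.
Import numFieldNormedType.Exports.
Local Open Scope classical_set_scope.
Local Open Scope ring_scope.

(** In the variables [q] and [k = r q], a firm maximizes a concave quadratic
over the cone [0 <= k <= q].  Write [P = A - c - d - Q] for the unit margin of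
clean output, [beta = b alpha^2] for the weighted climate belief, and
[s = d - beta (K + k)] for the marginal profit of carbon.  Then the first-order
conditions at an active firm read [q = max(P, P + s)], with [q = P] unless the
firm is fully dirty ([k = q]) and [q = P + s] unless it is fully clean
([k = 0]).  So an equilibrium is coupled only through the two aggregates [Q]
and [K], and everything follows from comparing two equilibria.

Two facts about a single firm carry the comparison.  If its belief and [K]
go up and [P] goes down, its output does not rise
([firm_optimal_output_le]); if its belief, [K] and [P] all go up, its carbon
rises by no more than its output ([firm_optimal_carbon_le_output]).  Suppose
beliefs go up weakly and [K] does not fall.  A fall of [P] would lower every
output, hence [Q], hence raise [P]; so [P] does not fall, and summing the
second fact gives that the change of [K] is at most that of [Q], which is
minus that of [P], hence nonpositive.  So nothing changes in the aggregates
([foc_rigid]).  This yields at once that [K] is weakly decreasing, that the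
aggregates are unique, and that [K] strictly falls when the belief of an
emitting firm rises.

For [Q], let the belief of [j] rise, so that [K] does not rise; all other
firms then obey the two facts with the roles of the equilibria exchanged.  If
[j] is red and [Q] did not fall, every firm would cut carbon by at most what it
cuts in output, so [K] would not fall.  If [j] is orange and [Q] did not rise,
[P] would not fall, so no output would fall, while a red firm, facing a strictly
smaller [K], would strictly expand.  Without red firms all outputs equal [P],
which determines [Q].  If [j] is green, its choice stays optimal for a higher
belief, so uniqueness applies.

Colors are known only in the interior of the interval of beliefs.  The end
points are reached because both aggregates are Lipschitz in the belief of [j]
on compact segments ([foc_lipschitz]), again by comparison. *)

(** * Optimal choice of one firm *)

(** Derivative of the profit in the carbon [k], the total carbon [K] of the
economy being evaluated at the optimum; own emissions enter once through [K]
and once more through the quadratic damage term. *)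
Definition carbon_margin (R : realFieldType) (d beta K k : R) : R :=
  d - beta * (K + k).

(** First-order conditions over the cone [0 <= k <= q] at an active firm, where
[P] is the unit margin of clean output.  The two inequalities on [P] say that
profit does not increase along the directions (1, 0) and (1, 1), which generate
the cone; the implications are complementary slackness. *)
Record firm_optimal (R : realFieldType) (d beta P K q k : R) : Prop :=
  FirmOptimal {
    carbon_ge0 : 0 <= k;
    carbon_le_output : k <= q;
    output_gt0 : 0 < q;
    output_ge_price : P <= q;
    output_ge_dirty_price : P + carbon_margin d beta K k <= q;
    clean_output : k < q -> q = P;
    dirty_output : 0 < k -> q = P + carbon_margin d beta K k
  }.

Section FirmComparison.
Variables (R : realFieldType) (d : R).

Lemma carbon_margin_le0 (beta P K q k : R) :
  firm_optimal d beta P K q k -> k < q -> carbon_margin d beta K k <= 0.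
Proof.
by case=> _ _ _ _ h clean _ /clean qP; rewrite -(lerD2l P) addr0 -[leRHS]qP.
Qed.

Lemma carbon_margin_ge0 (beta P K q k : R) :
  firm_optimal d beta P K q k -> 0 < k -> 0 <= carbon_margin d beta K k.
Proof.
by case=> _ _ _ h _ _ dirty /dirty qP; rewrite -(lerD2l P) addr0 -qP.
Qed.

(** A firm whose output rose above [P >= P'] would have to be red with a larger
marginal profit of carbon; but both its own carbon and [K] would be larger,
which lowers that profit. *)
Lemma firm_optimal_output_le (beta beta' P P' K K' q q' k k' : R) :
    0 <= beta -> beta <= beta' -> 0 <= K -> K <= K' -> P' <= P ->
    firm_optimal d beta P K q k -> firm_optimal d beta' P' K' q' k' ->
  q' <= q.
Proof.
move=> b0 bb K0 KK PP o o'; rewrite leNgt; apply/negP => qq.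
have k'q' : k' = q'.
  apply/eqP; rewrite eq_le (carbon_le_output o') leNgt; apply/negP => kq.
  by have := clean_output o' kq; have := output_ge_price o; lra.
have := output_ge_dirty_price o; have := dirty_output o'.
have := carbon_ge0 o; have := carbon_le_output o; have := output_gt0 o.
rewrite /carbon_margin k'q' => q0 kq k0 /(_ (lt_trans q0 qq)) ? ?.
have : beta * (K + k) <= beta' * (K' + q') by apply: ler_pM => //; lra.
lra.
Qed.

(** A firm that starts red cannot expand carbon more than output, since
[k' <= q'].  A firm that starts with [k < q] produces [P], so its output does not
fall; and [K + k] has already reached its target [d / beta], which shrinks as the
belief rises, so its carbon does not rise. *)
Lemma firm_optimal_carbon_le_output
    (beta beta' P P' K K' q q' k k' : R) :
    0 < beta -> beta <= beta' -> 0 <= K -> K <= K' -> P <= P' ->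
    firm_optimal d beta P K q k -> firm_optimal d beta' P' K' q' k' ->
  k' - k <= q' - q.
Proof.
move=> b0 bb K0 KK PP o o'; have := carbon_le_output o'.
have := carbon_le_output o; rewrite le_eqVlt => /predU1P[->|kq]; first by lra.
have := carbon_margin_le0 o kq; have := clean_output o kq.
have := output_ge_price o'; have := carbon_ge0 o.
case: (leP k' k) => [|kk]; first by lra.
move=> k0; have := carbon_margin_ge0 o' (le_lt_trans k0 kk).
rewrite /carbon_margin => ? ? ? ?.
have : beta * (K + k) < beta' * (K' + k').
  apply: (lt_le_trans (y := beta * (K' + k'))).
    by rewrite ltr_pM2l //; lra.
  by rewrite ler_wpM2r //; lra.
lra.
Qed.

(** A clean firm has no incentive to emit, and less so with a higher belief. *)
Lemma firm_optimal_clean_mono (beta beta' P K q k : R) :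
    beta <= beta' -> 0 <= K -> k = 0 ->
    firm_optimal d beta P K q k -> firm_optimal d beta' P K q k.
Proof.
move=> bb K0 k0 o; have q0 := output_gt0 o; move: o; rewrite k0 => o.
have := clean_output o q0.
case: o => ? ? ? ?; rewrite /carbon_margin => ? ? ? ?; split=> //.
  have : beta * (K + 0) <= beta' * (K + 0) by rewrite ler_wpM2r //; lra.
  by rewrite /carbon_margin; lra.
by rewrite ltxx.
Qed.

Lemma firm_optimal_carbon_lt (beta beta' P K q q' k k' : R) :
    0 <= beta -> beta < beta' -> 0 <= K -> 0 < k ->
    firm_optimal d beta P K q k -> firm_optimal d beta' P K q' k' ->
  k' < k.
Proof.
move=> b0 bb K0 k0 o o'; rewrite ltNge; apply/negP => kk.
have := dirty_output o' (lt_le_trans k0 kk); have := dirty_output o k0.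
have := carbon_le_output o'; have := output_ge_price o'.
rewrite /carbon_margin => Pq' kq' qE q'E.
have : beta * (K + k) < beta' * (K + k').
  apply: (le_lt_trans (y := beta * (K + k'))).
    by rewrite ler_wpM2l //; lra.
  by rewrite ltr_pM2r //; lra.
case: (ltP k q) => [/(clean_output o)|]; lra.
Qed.

(** The numbers [X] and [X'] stand for [K + k] of the firm whose belief changes.
Since [d / beta] is its target for [K + k], the bound [eta] is the change of
that target, written without division. *)
Lemma emission_gap_le (beta beta' eta X X' : R) :
    0 < beta -> beta <= beta' -> d * (beta' - beta) <= beta * beta' * eta ->
    beta * X <= d -> d <= beta' * X' \/ beta * X <= beta' * X' <= d ->
  X - X' <= eta.
Proof.
move=> b0 bb he Xd h; have b'0 : 0 < beta' by lra.
rewrite -(ler_pM2l (mulr_gt0 b0 b'0)); apply: le_trans he.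
case: h => [dX'|/andP[XX X'd]].
  have : beta' * (beta * X) <= beta' * d by rewrite ler_pM2l.
  have : beta * d <= beta * (beta' * X') by rewrite ler_pM2l.
  lra.
have : beta' * (beta * X) <= beta' * (beta' * X') by rewrite ler_pM2l.
have : (beta' - beta) * (beta' * X') <= (beta' - beta) * d.
  by rewrite ler_wpM2l //; lra.
lra.
Qed.

End FirmComparison.

(** * Comparison of two equilibria *)

(** With [M = A - c - d], the unit margin of clean output is [M] minus total
output. *)
Definition foc_equilibrium (R : realFieldType) (n : nat) (M d Kex : R)
    (beta q k : 'I_n -> R) : Prop :=
  forall i, firm_optimal d (beta i)
    (M - \sum_j q j) (Kex + \sum_j k j) (q i) (k i).

Section Aggregates.
Variables (R : realFieldType) (n : nat) (M d Kex : R).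
Hypothesis Kex_ge0 : 0 <= Kex.
Implicit Types beta q k : 'I_n -> R.

Local Notation foc := (foc_equilibrium M d Kex).

Lemma foc_carbon_ge0 beta q k : foc beta q k -> 0 <= Kex + \sum_i k i.
Proof.
by move=> E; rewrite addr_ge0 // sumr_ge0 // => i _; exact: carbon_ge0 (E i).
Qed.

(** The heart of the comparison: more climate concern cannot go along with more
carbon. *)
Lemma foc_rigid beta beta' q q' k k' :
    (forall i, 0 < beta i) -> (forall i, beta i <= beta' i) ->
    foc beta q k -> foc beta' q' k' -> \sum_i k i <= \sum_i k' i ->
  \sum_i k' i = \sum_i k i /\ \sum_i q' i = \sum_i q i.
Proof.
move=> b0 bb E E' KK; have K0 := foc_carbon_ge0 E.
have KK' : Kex + \sum_i k i <= Kex + \sum_i k' i by rewrite lerD2l.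
have QQ : \sum_i q' i <= \sum_i q i.
  rewrite leNgt; apply/negP => QQ.
  have : \sum_i q' i <= \sum_i q i.
    apply: ler_sum => i _.
    by apply: firm_optimal_output_le KK' _ (E i) (E' i) => //; [exact: ltW|lra].
  by rewrite leNgt QQ.
have : \sum_i (k' i - k i) <= \sum_i (q' i - q i).
  apply: ler_sum => i _.
  by apply: firm_optimal_carbon_le_output KK' _ (E i) (E' i) => //; lra.
by rewrite !sumrB; split; lra.
Qed.

Lemma foc_carbon_le beta beta' q q' k k' :
    (forall i, 0 < beta i) -> (forall i, beta i <= beta' i) ->
    foc beta q k -> foc beta' q' k' ->
  \sum_i k' i <= \sum_i k i.
Proof.
move=> b0 bb E E'; case/orP: (le_total (\sum_i k' i) (\sum_i k i)) => // KK.
by have [KE _] := foc_rigid b0 bb E E' KK; rewrite KE.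
Qed.

Lemma foc_unique beta q q' k k' :
    (forall i, 0 < beta i) -> foc beta q k -> foc beta q' k' ->
  \sum_i k' i = \sum_i k i /\ \sum_i q' i = \sum_i q i.
Proof.
move=> b0 E E'; case/orP: (le_total (\sum_i k i) (\sum_i k' i)) => KK.
  exact: foc_rigid E E' KK.
by have [-> ->] := foc_rigid b0 (fun=> lexx _) E' E KK.
Qed.

(** If carbon did not fall, both aggregates would be unchanged, so no firm would
emit more, while [j] would emit strictly less. *)
Lemma foc_carbon_lt beta beta' q q' k k' (j : 'I_n) :
    (forall i, 0 < beta i) -> (forall i, beta i <= beta' i) ->
    beta j < beta' j -> 0 < k j ->
    foc beta q k -> foc beta' q' k' ->
  \sum_i k' i < \sum_i k i.
Proof.
move=> b0 bb bj kj E E'; have K0 := foc_carbon_ge0 E.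
rewrite ltNge; apply/negP => /(foc_rigid b0 bb E E')[KE QE].
have E'' i : firm_optimal d (beta' i) (M - \sum_i q i) (Kex + \sum_i k i)
    (q' i) (k' i) by move: (E' i); rewrite KE QE.
have kk i : k' i <= k i.
  have := firm_optimal_carbon_le_output (b0 i) (bb i) K0 (lexx _) (lexx _)
    (E i) (E'' i).
  have := firm_optimal_output_le (ltW (b0 i)) (bb i) K0 (lexx _) (lexx _)
    (E i) (E'' i).
  lra.
have kjj := firm_optimal_carbon_lt (ltW (b0 j)) bj K0 kj (E j) (E'' j).
have : \sum_i k' i < \sum_i k i.
  rewrite (bigD1 j) //= [ltRHS](bigD1 j) //=.
  by apply: ltr_leD => //; apply: ler_sum.
by rewrite KE ltxx.
Qed.

Section OneBelief.
Variables (j : 'I_n) (beta beta' q q' k k' : 'I_n -> R).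
Hypothesis beta_gt0 : forall i, 0 < beta i.
Hypothesis beta_off : forall i, i != j -> beta' i = beta i.
Hypothesis beta_j : beta j < beta' j.
Hypothesis E : foc beta q k.
Hypothesis E' : foc beta' q' k'.

Let beta_le i : beta i <= beta' i.
Proof. by case: (eqVneq i j) => [->|/beta_off->//]; exact: ltW. Qed.

Let K_ge0 := foc_carbon_ge0 E.
Let K'_ge0 := foc_carbon_ge0 E'.
Let K_le := foc_carbon_le beta_gt0 beta_le E E'.

Let K_le_ex : Kex + \sum_i k' i <= Kex + \sum_i k i.
Proof. by rewrite lerD2l. Qed.

(** The choices for the lower belief of a clean firm [j] remain an equilibrium for
the higher one, and the aggregates of an equilibrium are unique. *)
Lemma foc_green : k j = 0 ->
  \sum_i k' i = \sum_i k i /\ \sum_i q' i = \sum_i q i.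
Proof.
move=> kj0; apply: (@foc_unique beta') => // [i|i].
  exact: lt_le_trans (beta_gt0 i) (beta_le i).
case: (eqVneq i j) => [->|/beta_off->]; last exact: E.
exact: firm_optimal_clean_mono (beta_le j) K_ge0 kj0 (E j).
Qed.

(** As carbon does not rise with the belief of [j], the comparisons for a single
firm apply to all other firms with the two equilibria exchanged. *)
Lemma foc_others_output i : i != j -> \sum_i q' i <= \sum_i q i ->
  q i <= q' i.
Proof.
move=> ij QQ; have := E' i; rewrite (beta_off ij) => E'i.
by apply: firm_optimal_output_le K_le_ex _ E'i (E i) => //; [exact: ltW|lra].
Qed.

Lemma foc_others_carbon i : i != j -> \sum_i q i <= \sum_i q' i ->
  k i - k' i <= q i - q' i.
Proof.
move=> ij QQ; have := E' i; rewrite (beta_off ij) => E'i.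
by apply: firm_optimal_carbon_le_output K_le_ex _ E'i (E i) => //; lra.
Qed.

(** Redness at the higher belief, [k' j = q' j], is what keeps the carbon of [j]
from falling by more than its output. *)
Lemma foc_red : k' j = q' j -> 0 < k j -> \sum_i q' i < \sum_i q i.
Proof.
move=> red kj; rewrite ltNge; apply/negP => QQ.
have : \sum_i (k i - k' i) <= \sum_i (q i - q' i).
  apply: ler_sum => i _; case: (eqVneq i j) => [->|ij].
    by rewrite red lerD2r; exact: carbon_le_output (E j).
  exact: foc_others_carbon.
have := foc_carbon_lt beta_gt0 beta_le beta_j kj E E'.
rewrite !sumrB; lra.
Qed.

Lemma foc_orange_output_le i : k j < q j -> \sum_i q' i <= \sum_i q i ->
  q i <= q' i.
Proof.
move=> orange QQ; case: (eqVneq i j) => [->|ij]; last exact: foc_others_output.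
by have := output_ge_price (E' j); rewrite (clean_output (E j) orange); lra.
Qed.

(** If [Q] did not rise, no firm would cut its output, and the red firm [l] would
expand because [K] falls strictly. *)
Lemma foc_orange_lt l : k j < q j -> 0 < k j -> k l = q l -> k' l = q' l ->
  \sum_i q i < \sum_i q' i.
Proof.
move=> orange kj red red'.
have lj : l != j by apply: contraTneq orange => <-; rewrite red ltxx.
have KK := foc_carbon_lt beta_gt0 beta_le beta_j kj E E'.
rewrite ltNge; apply/negP => QQ.
have ql : q l < q' l.
  have := dirty_output (E' l); rewrite red' => /(_ (output_gt0 (E' l))).
  have := dirty_output (E l); rewrite red => /(_ (output_gt0 (E l))).
  rewrite /carbon_margin (beta_off lj) => qE q'E.
  rewrite ltNge; apply/negP => qq.
  have : beta l * (Kex + \sum_i k' i + q' l) < beta l * (Kex + \sum_i k i + q l).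
    by rewrite ltr_pM2l //; lra.
  lra.
have : \sum_i q i < \sum_i q' i.
  rewrite (bigD1 l) //= [ltRHS](bigD1 l) //=.
  apply: ltr_leD => //; apply: ler_sum => i _; exact: foc_orange_output_le.
lra.
Qed.

(** If [Q] does not fall, the other firms cut carbon by at most what they cut in
output, and [j] exceeds this by at most [eta].  If [Q] falls, no other firm cuts
output, so [j] does; it was then red, so its cut in carbon is at least its cut in
output, and that cut in carbon together with the fall of [K] is at most [eta]. *)
Lemma foc_lipschitz eta : 0 < d ->
    d * (beta' j - beta j) <= beta j * beta' j * eta ->
  `|\sum_i k' i - \sum_i k i| <= eta /\ `|\sum_i q' i - \sum_i q i| <= eta.
Proof.
move=> d0 he.
have eta0 : 0 <= eta.
  rewrite -(pmulr_rge0 eta (mulr_gt0 (beta_gt0 j) (lt_trans (beta_gt0 j) beta_j))).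
  by apply: le_trans he; rewrite mulr_ge0 ?subr_ge0 ?ltW.
have KK := K_le; have gap := emission_gap_le (beta_gt0 j) (beta_le j) he.
rewrite !ler_norml.
case: (leP (\sum_i q i) (\sum_i q' i)) => QQ.
  have kj : k j - k' j <= q j - q' j + eta.
    have := carbon_le_output (E j); have := carbon_le_output (E' j).
    rewrite le_eqVlt => /predU1P[->|k'q']; first by lra.
    have := clean_output (E' j) k'q'; have := output_ge_price (E j).
    case: (leP (k j) 0) => [|k0]; first by have := carbon_ge0 (E' j); lra.
    have := carbon_margin_le0 (E' j) k'q'; have := carbon_margin_ge0 (E j) k0.
    rewrite /carbon_margin => s s' ? ? ?.
    have : (Kex + \sum_i k i + k j) - (Kex + \sum_i k' i + k' j) <= eta.
      by apply: gap; [lra|left; lra].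
    lra.
  have : \sum_i (k i - k' i) <= \sum_i (q i - q' i) + eta.
    rewrite (bigD1 j) //= [X in X + eta](bigD1 j) //= [leRHS]addrAC.
    apply: lerD => //; apply: ler_sum => i ij; exact: foc_others_carbon.
  by rewrite !sumrB; split; apply/andP; split; lra.
have Qj : \sum_i q i - \sum_i q' i <= q j - q' j.
  rewrite (bigD1 j) //= [X in _ - X](bigD1 j) //=.
  have : \sum_(i | i != j) q i <= \sum_(i | i != j) q' i.
    by apply: ler_sum => i ij; apply: foc_others_output => //; lra.
  lra.
have kq : k j = q j.
  apply/eqP; rewrite eq_le (carbon_le_output (E j)) leNgt; apply/negP => kq.
  by have := clean_output (E j) kq; have := output_ge_price (E' j); lra.
have k0 : 0 < k j by rewrite kq; exact: output_gt0 (E j).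
have : (Kex + \sum_i k i + k j) - (Kex + \sum_i k' i + k' j) <= eta.
  have := carbon_margin_ge0 (E j) k0; have := dirty_output (E j) k0.
  have := output_ge_dirty_price (E' j); rewrite /carbon_margin => ? ? ?.
  apply: gap; first by lra.
  case: (leP d (beta' j * (Kex + \sum_i k' i + k' j))) => [|X'd]; first by left.
  by right; apply/andP; split; lra.
have := carbon_le_output (E' j).
by split; apply/andP; split; lra.
Qed.

End OneBelief.

(** Every output equals [M - Q], so that [Q = n (M - Q)]. *)
Lemma foc_no_red beta q k : foc beta q k -> (forall i, k i < q i) ->
  \sum_i q i = n%:R * M / (1 + n%:R).
Proof.
move=> E clean; apply: (canRL (mulfK _)).
  by rewrite paddr_eq0 // oner_eq0.
have : \sum_(i < n) q i = \sum_(i < n) (M - \sum_i q i).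
  by apply: eq_bigr => i _; exact: clean_output (E i) (clean i).
rewrite [RHS]sumr_const card_ord -[RHS]mulr_natl; lra.
Qed.

End Aggregates.

(** * First-order conditions in equilibrium *)

Section FirstOrderConditions.
Variable R : realType.
Implicit Types A b c d a Qo Ko r q k u v : R.

Lemma slope_le0 (g N : R) : 0 <= N ->
  (forall t, 0 < t -> t <= 1 -> t * g - t ^+ 2 * N <= 0) -> g <= 0.
Proof.
move=> N0 H; rewrite leNgt; apply/negP => g0.
(* At [t = g / (g + N)] the linear term dominates. *)
have gN : 0 < g + N by lra.
have t0 : 0 < g / (g + N) by rewrite divr_gt0.
have := H _ t0; rewrite ler_pdivrMr // mul1r lerDl => /(_ N0).
rewrite expr2 -mulrA -mulrBr pmulr_rle0 // subr_le0 mulrAC ler_pdivlMr //.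
by rewrite ler_pM2l //; lra.
Qed.

(** The profit as a function of output and carbon, without the truncation of the
price at zero. *)
Definition smooth_profit A beta c d Qo Ko q k : R :=
  (A - q - Qo) * q - beta * (k + Ko) * k - (c + d) * q + d * k.

Lemma smooth_profit_le (A b c d a Qo Ko r q : R) : 0 <= q ->
  smooth_profit A (b * a) c d Qo Ko q (r * q) <= profit A b c d a Qo Ko r q.
Proof.
move=> q0; rewrite /smooth_profit /profit.
have : (A - q - Qo) * q <= Num.max (A - q - Qo) 0 * q.
  by rewrite ler_wpM2r // le_max lexx.
lra.
Qed.

(** If [A < q + Qo], the truncated price is zero, so the firm only bears costs and
would do better by shutting down. *)
Lemma optimal_price_ge0 A b c d a Qo Ko r q :
    0 < b -> 0 < c -> 0 < d -> 0 < a -> 0 <= Ko -> 0 <= r <= 1 -> 0 < q ->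
    (forall r' q', 0 <= r' <= 1 -> 0 <= q' ->
      profit A b c d a Qo Ko r' q' <= profit A b c d a Qo Ko r q) ->
  0 <= A - q - Qo.
Proof.
move=> b0 c0 d0 a0 Ko0 /andP[r0 r1] q0 /(_ 0 0); rewrite lexx ler01 => H.
have {H} := H isT isT; rewrite leNgt => H; apply: contraNle H => neg.
rewrite /profit !(mulr0, mul0r) !subr0 (max_idPr (ltW neg)) mul0r sub0r.
have k0 : 0 <= r * q by rewrite mulr_ge0 // ltW.
have : 0 <= b * a * (r * q + Ko) * (r * q).
  by rewrite !mulr_ge0 ?addr_ge0 // ltW.
have : 0 < (c + d - d * r) * q.
  have : d * r <= d by rewrite ler_piMr // ltW.
  by move=> ?; rewrite mulr_gt0 //; lra.
lra.
Qed.

(** Truncating the price can only raise profits, and it is inactive at the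
optimum.  So the optimum also maximizes the smooth profit over the convex cone
[0 <= k <= q], and directional derivatives into the cone are nonpositive. *)
Lemma optimal_slope_le0 A b c d a Qo Ko r q u v :
    0 < b -> 0 < c -> 0 < d -> 0 < a -> 0 <= Ko -> 0 <= r <= 1 -> 0 < q ->
    (forall r' q', 0 <= r' <= 1 -> 0 <= q' ->
      profit A b c d a Qo Ko r' q' <= profit A b c d a Qo Ko r q) ->
    0 <= r * q + v <= q + u ->
  (A - (q + Qo) - c - d - q) * u
    + carbon_margin d (b * a) (Ko + r * q) (r * q) * v <= 0.
Proof.
move=> b0 c0 d0 a0 Ko0 r01 q0 opt /andP[kv0 kvqu].
have price := optimal_price_ge0 b0 c0 d0 a0 Ko0 r01 q0 opt.
have /andP[r0 r1] := r01.
have k0 : 0 <= r * q by rewrite mulr_ge0 // ltW.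
have kq : r * q <= q by rewrite ler_piMl // ltW.
apply: (@slope_le0 _ (u ^+ 2 + b * a * v ^+ 2)).
  by rewrite addr_ge0 ?sqr_ge0 // mulr_ge0 ?sqr_ge0 // ltW // mulr_gt0.
move=> t t0 t1.
have k't : 0 <= r * q + t * v.
  rewrite (_ : _ + _ = (1 - t) * (r * q) + t * (r * q + v)); last by ring.
  by rewrite addr_ge0 // mulr_ge0 //; lra.
have k'q' : r * q + t * v <= q + t * u.
  rewrite (_ : _ + _ = (1 - t) * (r * q) + t * (r * q + v)); last by ring.
  rewrite (_ : q + _ = (1 - t) * q + t * (q + u)); last by ring.
  by rewrite lerD // ler_wpM2l //; lra.
set q' := q + t * u in k'q' *; set k' := r * q + t * v in k't k'q' *.
have q'0 : 0 <= q' by exact: le_trans k'q'.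
(* At the apex [q' = k' = 0], and the technology [k' / q'] defaults to zero. *)
have r'q' : k' / q' * q' = k'.
  case: (eqVneq q' 0) => [q'E|?]; last by rewrite divfK.
  by apply/eqP; rewrite q'E mulr0 eq_sym eq_le k't -q'E k'q'.
have r'01 : 0 <= k' / q' <= 1.
  rewrite divr_ge0 //=; move: q'0; rewrite le_eqVlt => /predU1P[<-|q'0].
    by rewrite invr0 mulr0.
  by rewrite ler_pdivrMr // mul1r.
have := le_trans (smooth_profit_le A b c d a Qo Ko (k' / q') q'0)
  (opt _ _ r'01 q'0).
rewrite r'q' /smooth_profit /profit (max_idPl price) /carbon_margin /q' /k'.
lra.
Qed.

(** The directions are (1, 0), (1, 1), and the one towards the apex of the
cone, which gives complementary slackness. *)
Lemma profit_max_firm_optimal A b c d a Qo Ko r q :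
    0 < b -> 0 < c -> 0 < d -> 0 < a -> 0 <= Ko -> 0 <= r <= 1 -> 0 < q ->
    (forall r' q', 0 <= r' <= 1 -> 0 <= q' ->
      profit A b c d a Qo Ko r' q' <= profit A b c d a Qo Ko r q) ->
  firm_optimal d (b * a) (A - c - d - (q + Qo)) (Ko + r * q) q (r * q).
Proof.
move=> b0 c0 d0 a0 Ko0 r01 q0 opt.
have slope u v := @optimal_slope_le0 A b c d a Qo Ko r q u v
  b0 c0 d0 a0 Ko0 r01 q0 opt.
have /andP[r0 r1] := r01.
have k0 : 0 <= r * q by rewrite mulr_ge0 // ltW.
have kq : r * q <= q by rewrite ler_piMl // ltW.
move: slope; set s := carbon_margin _ _ _ _; set k := r * q in k0 kq *.
set P := A - c - d - (q + Qo) => slope.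
have Pq : P <= q.
  have : 0 <= k + 0 <= q + 1 by apply/andP; split; lra.
  by move/slope; rewrite /P; lra.
have Psq : P + s <= q.
  have : 0 <= k + 1 <= q + 1 by apply/andP; split; lra.
  by move/slope; rewrite /P; lra.
have scale : 0 <= (P - q) * (q - k) + (P + s - q) * k.
  have : 0 <= k + - k <= q + - q by apply/andP; split; lra.
  by move/slope; rewrite /P; lra.
have cl : (P - q) * (q - k) <= 0 by rewrite mulr_le0_ge0 //; lra.
have di : (P + s - q) * k <= 0 by rewrite mulr_le0_ge0 //; lra.
split=> // [kltq|kgt0]; apply/eqP; rewrite eq_le ?Pq ?Psq ?andbT.
  have : 0 <= (P - q) * (q - k) by lra.
  by rewrite pmulr_lge0 ?subr_gt0 // subr_ge0.
have : 0 <= (P + s - q) * k by lra.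
by rewrite pmulr_lge0 // subr_ge0.
Qed.

End FirstOrderConditions.

Lemma equilibrium_foc (R : realType) (n : nat) (A b c d Kex : R)
    (a : 'I_n -> R) (p : profile R n) :
    0 < b -> 0 < c -> 0 < d -> 0 <= Kex -> (forall i, 0 < a i) ->
    (forall i, ~~ has_color p i White) ->
    equilibrium A b c d Kex a p ->
  foc_equilibrium (A - c - d) d Kex (fun i => b * a i)
    (qty p) (fun i => tech p i * qty p i).
Proof.
move=> b0 c0 d0 K0 a0 nw eq i; have [r01 q0 opt _] := eq i.
have q_gt0 : 0 < qty p i by rewrite lt_def q0 andbT; exact: nw.
have Ko0 : 0 <= others_carbon Kex p i.
  rewrite addr_ge0 // sumr_ge0 // => l _; have [/andP[r0 _] ql0 _ _] := eq l.
  exact: mulr_ge0.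
have -> : \sum_l qty p l = qty p i + others_quantity p i by rewrite (bigD1 i).
have -> : Kex + \sum_l tech p l * qty p l
    = others_carbon Kex p i + tech p i * qty p i.
  by rewrite (bigD1 i) //= addrA addrAC.
exact: profit_max_firm_optimal b0 c0 d0 (a0 i) Ko0 r01 q_gt0 opt.
Qed.

(** * From the interior of an interval to its end points *)

Definition lipschitz_on_segments (R : realFieldType) (J : set R) (f : R -> R) :=
  forall x y, J x -> J y -> x < y -> exists L, forall u v,
    x <= u -> u < v -> v <= y -> `|f v - f u| <= L * (v - u).

Lemma le_endpoints (R : realFieldType) (f : R -> R) (x y L : R) : x < y ->
    (forall u v, x <= u -> u < v -> v <= y -> `|f v - f u| <= L * (v - u)) ->
    (forall u v, x < u -> u < v -> v < y -> f u <= f v) ->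
  f x <= f y.
Proof.
move=> xy lip mono; rewrite leNgt; apply/negP => fyx.
have L0 : 0 <= L.
  have := le_trans (normr_ge0 _) (lip x y (lexx _) xy (lexx _)).
  by rewrite pmulr_lge0 // subr_gt0.
(* Moving both end points inwards by [t] changes each value of [f] by at most a
   third of the supposed gap. *)
pose t := Num.min ((y - x) / 3) ((f x - f y) / (3 * (L + 1))).
have t0 : 0 < t.
  by rewrite lt_min !divr_gt0 ?mulr_gt0 //; lra.
have ty : t <= (y - x) / 3 by rewrite ge_min lexx.
have Lt : (L + 1) * t <= (f x - f y) / 3.
  have : t <= (f x - f y) / (3 * (L + 1)) by rewrite ge_min lexx orbT.
  by rewrite ler_pdivlMr; [lra|rewrite mulr_gt0 //; lra].
have near_x : `|f (x + t) - f x| <= L * (x + t - x) by apply: lip; lra.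
have near_y : `|f y - f (y - t)| <= L * (y - (y - t)) by apply: lip; lra.
have inner : f (x + t) <= f (y - t) by apply: mono; lra.
by move: near_x near_y; rewrite !ler_norml => /andP[? ?] /andP[? ?]; lra.
Qed.

Lemma is_interval_interior (R : realType) (J : set R) (x y u : R) :
  is_interval J -> J x -> J y -> x < u -> u < y -> interior J u.
Proof.
move=> itv Jx Jy xu uy; rewrite /interior /=.
have u_in : u \in `]x, y[%R by rewrite in_itv /= xu.
apply: filterS (near_in_itvoo u_in) => v; rewrite in_itv /= => /andP[xv vy].
by apply: itv Jx Jy _ _; rewrite !ltW.
Qed.

Section InteriorToInterval.
Variables (R : realType) (J : set R).
Hypothesis J_itv : is_interval J.
Implicit Type f : R -> R.

Lemma lipschitz_on_segmentsN f :
  lipschitz_on_segments J f -> lipschitz_on_segments J (fun x => - f x).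
Proof.
move=> lip x y Jx Jy xy; have [L HL] := lip _ _ Jx Jy xy.
by exists L => u v ? ? ?; rewrite -opprD normrN; exact: HL.
Qed.

Lemma interior_le f : lipschitz_on_segments J f ->
    (forall u v, interior J u -> interior J v -> u < v -> f u <= f v) ->
  forall x y, J x -> J y -> x < y -> f x <= f y.
Proof.
move=> lip mono x y Jx Jy xy; have [L HL] := lip _ _ Jx Jy xy.
apply: le_endpoints xy HL _ => u v xu uv vy; apply: mono => //.
  exact: is_interval_interior J_itv Jx Jy xu (lt_trans uv vy).
exact: is_interval_interior J_itv Jx Jy (lt_trans xu uv) vy.
Qed.

Lemma interior_lt f :
    (forall x y, J x -> J y -> x < y -> f x <= f y) ->
    (forall u v, interior J u -> interior J v -> u < v -> f u < f v) ->
  forall x y, J x -> J y -> x < y -> f x < f y.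
Proof.
move=> fle flt x y Jx Jy xy.
pose u := x + (y - x) / 3; pose v := y - (y - x) / 3.
have xu : x < u by rewrite /u; lra.
have uv : u < v by rewrite /u /v; lra.
have vy : v < y by rewrite /v; lra.
have Iu := is_interval_interior J_itv Jx Jy xu (lt_trans uv vy).
have Iv := is_interval_interior J_itv Jx Jy (lt_trans xu uv) vy.
apply: le_lt_trans (fle _ _ Jx (interior_subset Iu) xu) _.
exact: lt_le_trans (flt _ _ Iu Iv uv) (fle _ _ (interior_subset Iv) Jy vy).
Qed.

Lemma interior_const f : lipschitz_on_segments J f ->
    (forall u v, interior J u -> interior J v -> u < v -> f u = f v) ->
  forall x y, J x -> J y -> f x = f y.
Proof.
move=> lip feq.
have lt x y : J x -> J y -> x < y -> f x = f y.
  move=> Jx Jy xy; apply/eqP; rewrite eq_le; apply/andP; split.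
    by apply: interior_le lip _ _ _ Jx Jy xy => u v Iu Iv /(feq _ _ Iu Iv)->.
  rewrite -lerN2.
  apply: (interior_le (lipschitz_on_segmentsN lip)) Jx Jy xy => u v Iu Iv.
  by move/(feq _ _ Iu Iv)->.
move=> x y Jx Jy; case: (ltgtP x y) => [xy|yx|->//]; first exact: lt.
by apply/esym/lt.
Qed.

End InteriorToInterval.

(** * Monotonicity of total carbon and total output *)

Lemma has_color_carbon (R : realType) (n : nat) (p : profile R n) (i : 'I_n)
    (col : color) : has_color p i col ->
  match col with
  | White => True
  | Green => tech p i * qty p i = 0
  | Orange => 0 < tech p i * qty p i < qty p i
  | Red => tech p i * qty p i = qty p i /\ 0 < qty p i
  end.
Proof.
case: col => //= /andP[q0].
- by move/eqP->; rewrite mul0r.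
- by case/andP=> r0 r1; rewrite mulr_gt0 //= gtr_pMl.
- by move/eqP->; rewrite mul1r.
Qed.

Theorem theorem4p1 (R : realType) (n : nat) (n_ge1 : (1 <= n)%N)
    (A b c d Kex : R)
    (A_gt0 : 0 < A) (b_gt0 : 0 < b) (c_gt0 : 0 < c) (d_gt0 : 0 < d)
    (Kex_ge0 : 0 <= Kex)
    (j : 'I_n) (a : 'I_n -> R)
    (a_gt0 : forall i : 'I_n, i != j -> 0 < a i)
    (J : set R) (J_itv : is_interval J)
    (J_nondeg : exists x y : R, [/\ J x, J y & x < y])
    (J_gt0 : J `<=` [set x | 0 < x])
    (e : R -> profile R n)
    (e_eq : forall x : R, J x ->
       equilibrium A b c d Kex (fun i : 'I_n => if i == j then x else a i)
         (e x))
    (e_nwhite : forall x : R, J x ->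
       forall i : 'I_n, ~~ has_color (e x) i White)
    (col : 'I_n -> color)
    (e_col : forall x : R, interior J x ->
       forall i : 'I_n, has_color (e x) i (col i)) :
  let K := fun x : R => total_carbon Kex (e x) in
  let Q := fun x : R => total_quantity (e x) in
  [/\ (forall x y : R, J x -> J y -> x <= y -> K y <= K x),
      (col j = Green -> forall x y : R, J x -> J y -> K x = K y) &
      (col j <> Green -> forall x y : R, J x -> J y -> x < y -> K y < K x)]
  /\
  [/\ (col j = Green -> forall x y : R, J x -> J y -> Q x = Q y),
      (col j = Red -> forall x y : R, J x -> J y -> x < y -> Q y < Q x),
      (col j = Orange -> (exists i : 'I_n, col i = Red) ->
         forall x y : R, J x -> J y -> x < y -> Q x < Q y) &
      (col j = Orange -> (forall i : 'I_n, col i <> Red) ->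
         forall x y : R, J x -> J y -> Q x = Q y)].
Proof.
pose bel (x : R) (i : 'I_n) : R := b * (if i == j then x else a i).
pose q x i := qty (e x) i; pose k x i := tech (e x) i * qty (e x) i.
have bel_gt0 x : J x -> forall i, 0 < bel x i.
  move=> Jx i; rewrite mulr_gt0 //; case: eqVneq => [_|/a_gt0 //].
  exact: J_gt0.
have bel_off x y i : i != j -> bel y i = bel x i by rewrite /bel => /negbTE->.
have bel_j x y : x < y -> bel x j < bel y j by rewrite /bel eqxx ltr_pM2l.
have bel_le x y i : x < y -> bel x i <= bel y i.
  by move=> xy; case: (eqVneq i j) => [->|/(bel_off x y)->//]; exact/ltW/bel_j.
have E x : J x -> foc_equilibrium (A - c - d) d Kex (bel x) (q x) (k x).
  move=> Jx; apply: equilibrium_foc (e_nwhite _ Jx) (e_eq _ Jx) => // i.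
  by rewrite -(pmulr_rgt0 _ b_gt0); exact: bel_gt0.
have colk x i := fun Ix : interior J x => has_color_carbon (e_col x Ix i).
have inJ x : interior J x -> J x by exact: interior_subset.
have lip x y : J x -> J y -> x < y -> exists L : R, forall u v,
    x <= u -> u < v -> v <= y ->
    `|\sum_i k v i - \sum_i k u i| <= L * (v - u) /\
    `|\sum_i q v i - \sum_i q u i| <= L * (v - u).
  move=> Jx Jy xy; have x0 : 0 < x := J_gt0 _ Jx.
  (* The target [d / (b u)] for [K + k] has derivative at most this constant in
     absolute value on [x <= u]. *)
  exists (d / (b * x ^+ 2)) => u v xu uv vy.
  have Ju : J u by apply: J_itv Jx Jy _ _; rewrite xu (le_trans (ltW uv) vy).
  have Jv : J v by apply: J_itv Jx Jy _ _; rewrite vy (le_trans xu (ltW uv)).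
  apply: (foc_lipschitz Kex_ge0 (bel_gt0 _ Ju) (bel_off u v) (bel_j _ _ uv)
    (E _ Ju) (E _ Jv) d_gt0).
  rewrite /bel !eqxx -mulrBr.
  have -> : b * u * (b * v) * (d / (b * x ^+ 2) * (v - u))
      = d * (b * (v - u)) * (u * v / x ^+ 2).
    by field; rewrite !gt_eqF.
  apply: ler_peMr; first by rewrite !mulr_ge0 ?subr_ge0 ?ltW.
  rewrite ler_pdivlMr ?exprn_gt0 // mul1r expr2.
  by apply: ler_pM => //; rewrite ?(ltW x0) // (le_trans xu) ?ltW.
have lipK : lipschitz_on_segments J (fun x => \sum_i k x i).
  move=> x y Jx Jy xy; have [L HL] := lip _ _ Jx Jy xy.
  by exists L => u v xu uv vy; have [] := HL _ _ xu uv vy.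
have lipQ : lipschitz_on_segments J (fun x => \sum_i q x i).
  move=> x y Jx Jy xy; have [L HL] := lip _ _ Jx Jy xy.
  by exists L => u v xu uv vy; have [] := HL _ _ xu uv vy.
have K_le x y : J x -> J y -> x < y -> \sum_i k y i <= \sum_i k x i.
  move=> Jx Jy xy.
  apply: (foc_carbon_le Kex_ge0 (bel_gt0 _ Jx) _ (E _ Jx) (E _ Jy)) => i.
  exact: bel_le.
split; split.
- move=> x y Jx Jy; rewrite le_eqVlt => /predU1P[->//|xy].
  by rewrite lerD2l; exact: K_le.
- move=> green x y Jx Jy; congr (_ + _).
  apply: (interior_const J_itv lipK) Jx Jy => u v Iu Iv uv.
  have := colk _ j Iu; rewrite green => kj.
  have [Ju Jv] := (inJ _ Iu, inJ _ Iv).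
  by have [] := foc_green Kex_ge0 (bel_gt0 _ Ju) (bel_off u v) (bel_j _ _ uv)
    (E _ Ju) (E _ Jv) kj.
- move=> ngreen x y Jx Jy xy; rewrite ltrD2l -ltrN2.
  apply: (interior_lt J_itv (f := fun x => - \sum_i k x i)) Jx Jy xy.
    by move=> x' y' Jx' Jy' xy'; rewrite lerN2; exact: K_le.
  move=> u v Iu Iv uv; have [Ju Jv] := (inJ _ Iu, inJ _ Iv).
  rewrite ltrN2; apply: (foc_carbon_lt Kex_ge0 (bel_gt0 _ Ju) _ (bel_j _ _ uv)
    _ (E _ Ju) (E _ Jv)) => [i|]; first exact: bel_le.
  have := colk _ j Iu; have := e_col _ Iu j; have := e_nwhite _ Ju j.
  rewrite /k; case: (col j) ngreen => // _ nwhite.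
  - by rewrite (negbTE nwhite).
  - by move=> _ /andP[].
  - by move=> _ [->].
- move=> green x y Jx Jy.
  apply: (interior_const J_itv lipQ) Jx Jy => u v Iu Iv uv.
  have := colk _ j Iu; rewrite green => kj.
  have [Ju Jv] := (inJ _ Iu, inJ _ Iv).
  by have [] := foc_green Kex_ge0 (bel_gt0 _ Ju) (bel_off u v) (bel_j _ _ uv)
    (E _ Ju) (E _ Jv) kj.
- move=> red x y Jx Jy xy; rewrite -ltrN2.
  have Q_lt u v : interior J u -> interior J v -> u < v ->
      - \sum_i q u i < - \sum_i q v i.
    move=> Iu Iv uv; have [Ju Jv] := (inJ _ Iu, inJ _ Iv); rewrite ltrN2.
    have := colk _ j Iu; have := colk _ j Iv; rewrite red => -[kv _] [ku qu].
    apply: (foc_red Kex_ge0 (bel_gt0 _ Ju) (bel_off u v) (bel_j _ _ uv)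
      (E _ Ju) (E _ Jv) kv).
    by rewrite /k ku.
  apply: (interior_lt J_itv (f := fun x => - \sum_i q x i)) Jx Jy xy;
    last exact: Q_lt.
  apply: (interior_le J_itv (lipschitz_on_segmentsN lipQ)) => u v Iu Iv uv.
  exact/ltW/Q_lt.
- move=> orange [l red] x y Jx Jy xy.
  have Q_lt u v : interior J u -> interior J v -> u < v ->
      \sum_i q u i < \sum_i q v i.
    move=> Iu Iv uv; have [Ju Jv] := (inJ _ Iu, inJ _ Iv).
    have := colk _ l Iu; have := colk _ l Iv; rewrite red => -[kv _] [ku _].
    have := colk _ j Iu; rewrite orange => /andP[k0 kq].
    exact: (foc_orange_lt Kex_ge0 (bel_gt0 _ Ju) (bel_off u v) (bel_j _ _ uv)
      (E _ Ju) (E _ Jv) kq k0 ku kv).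
  apply: (interior_lt J_itv (f := fun x => \sum_i q x i)) Jx Jy xy;
    last exact: Q_lt.
  by apply: (interior_le J_itv lipQ) => u v Iu Iv uv; exact/ltW/Q_lt.
- move=> orange nred x y Jx Jy.
  apply: (interior_const J_itv lipQ) Jx Jy => u v Iu Iv uv.
  have clean w : interior J w -> forall i, k w i < q w i.
    move=> Iw i; have := colk _ i Iw; have := e_col _ Iw i.
    have := e_nwhite _ (inJ _ Iw) i; move: (nred i); rewrite /k /q.
    case: (col i) => // _ nwhite.
    - by rewrite (negbTE nwhite).
    - by move=> /andP[? _] ->.
    - by move=> _ /andP[].
  by rewrite (foc_no_red (E _ (inJ _ Iu)) (clean _ Iu))
    (foc_no_red (E _ (inJ _ Iv)) (clean _ Iv)).
Qed.
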